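(* For every strong fixed-point context $\Upsilon_{A,\overline{c_0}}$ with $\overline{c_0}\subseteq\overline{c}$, every permutation $\pi$ and every nominal term $t$: $\mathsf{N}\,\overline{c}.\,\Upsilon_{A,\overline{c_0}}\vdash \pi\curlywedge t$ is derivable if and only if $\mathsf{N}\,\overline{c}.\,\Upsilon_{A,\overline{c_0}}\vdash \pi\cdot t\approx_\alpha t$ is derivable.
   Context: Nominal terms are built from atoms $a$, suspensions $\pi\cdot X$ (with $\pi$ a finite permutation of atoms and $X$ a variable), abstractions $[a]t$ and applications $\mathtt{f}(t_1,\dots,t_n)$. A fixed-point constraint $\pi\curlywedge t$ means ''the permutation $\pi$ fixes $t$''. $\mathsf{N}$ denotes Pitts' ''new'' quantifier (quantification over fresh atoms). A strong fixed-point context $\Upsilon_{A,C}$ is a finite set of primitive constraints of the form $\mathsf{N}c.(a\ c)\curlywedge X$ with $a\in A$, $c\in C$, for disjoint sets of atoms $A$ and $C$ (the $\mathsf{N}$-quantifiers are moved to the front). A strong fixed-point judgement has the form $\mathsf{N}\,\overline{c}.(\Upsilon_{A,\overline{c_0}}\vdash\pi\curlywedge t)$ and a strong $\alpha$-equality judgement has the form $\mathsf{N}\,\overline{c}.(\Upsilon_{A,\overline{c_0}}\vdash s\approx_\alpha t)$, where $\overline{c}$ is a list of distinct atoms and $\overline{c_0}\subseteq\overline{c}$. Derivability is with respect to the following rules (here $\mathrm{dom}(\mathrm{perm}(\Upsilon|_X))=\{a\mid (a\ c)\curlywedge X\in\Upsilon\}$ and $\pi^{\rho}=\rho\circ\pi\circ\rho^{-1}$):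 $\pi\curlywedge a$ if $\pi(a)=a$; $\pi\curlywedge\rho\cdot X$ if $\mathrm{dom}(\pi^{\rho^{-1}})\setminus\overline{c}\subseteq\mathrm{dom}(\mathrm{perm}(\Upsilon|_X))$; $\pi\curlywedge\mathtt{f}(t_1,\dots,t_n)$ from $\pi\curlywedge t_i$ for all $i$; $\pi\curlywedge[a]t$ from $\mathsf{N}\,\overline{c},c_1.\,\Upsilon\vdash\pi\curlywedge(a\ c_1)\cdot t$; $a\approx_\alpha a$; $\pi\cdot X\approx_\alpha\rho\cdot X$ if $\mathrm{dom}(\rho^{-1}\circ\pi)\setminus\overline{c}\subseteq\mathrm{dom}(\mathrm{perm}(\Upsilon|_X))$; congruence for $\mathtt{f}$ and for $[a]$; and $[a]s\approx_\alpha[b]t$ from $s\approx_\alpha(a\ b)\cdot t$ and $\mathsf{N}\,\overline{c},c_1.\,\Upsilon\vdash(a\ c_1)\curlywedge t$. *)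

(* Defs.v *)
From HB Require Import structures.
From mathcomp Require Import all_boot finmap.

Set Implicit Arguments.
Unset Strict Implicit.
Unset Printing Implicit Defensive.

Local Open Scope fset_scope.

(* [dom pi] is [finsupp pi], the finite set of atoms moved by [pi]. *)
Record fperm (atom : choiceType) := FPerm {
  fperm_fun :> {fsfun atom -> atom};
  fperm_inj : fsinjectiveb fperm_fun
}.

HB.instance Definition _ (atom : choiceType) :=
  [isSub for @fperm_fun atom].

Section Permutations.
Context {atom : choiceType}.
Implicit Types (pi rho : fperm atom) (a b x : atom).

Lemma comp_fperm_subproof pi rho : fsinjectiveb (fsfun_comp pi rho).
Proof.
apply/fsinjectiveP; apply: fscomp_inj; apply/fsinjectiveP; exact: fperm_inj.
Qed.

Definition comp_fperm pi rho : fperm atom := FPerm (comp_fperm_subproof pi rho).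

Lemma comp_fpermE pi rho x : comp_fperm pi rho x = pi (rho x).
Proof. by rewrite /= fscompE. Qed.

(* The unique [y] in [finsupp pi] with [pi y = x], when [x \in finsupp pi]. *)
Definition inv_fperm_fun pi : {fsfun atom -> atom} :=
  [fsfun x in finsupp pi =>
     nth x (finsupp pi) (index x [seq pi y | y <- finsupp pi])].

Lemma inv_fperm_funKV pi x : pi (inv_fperm_fun pi x) = x.
Proof.
rewrite /inv_fperm_fun fsfunE; case: ifPn => [xpi|]; last exact: fsfun_dflt.
have im_x : x \in [seq pi y | y <- finsupp pi].
  have /imfset_eq_fsinjectiveP eq_im := fperm_inj pi.
  move: xpi; rewrite -{1}eq_im => /imfsetP[y /= ypi ->].
  exact: map_f.
by rewrite -(nth_map x x) ?nth_index // -(size_map pi) index_mem.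
Qed.

Lemma inv_fperm_subproof pi : fsinjectiveb (inv_fperm_fun pi).
Proof. by apply/fsinjectiveP; apply: can_inj (inv_fperm_funKV pi). Qed.

Definition inv_fperm pi : fperm atom := FPerm (inv_fperm_subproof pi).

Lemma inv_fpermKV pi : cancel (inv_fperm pi) pi.
Proof. exact: inv_fperm_funKV. Qed.

Definition swap_fun a b : {fsfun atom -> atom} :=
  [fsfun x in [fset a; b] => if x == a then b else a].

Lemma swap_funE a b x :
  swap_fun a b x = if x == a then b else if x == b then a else x.
Proof. by rewrite /swap_fun fsfunE !inE; case: eqP => //; case: eqP. Qed.

Lemma swap_subproof a b : fsinjectiveb (swap_fun a b).
Proof.
apply/fsinjectiveP; apply: (can_inj (g := swap_fun a b)) => x.
rewrite !swap_funE; case: (eqVneq x a) => [->|xa].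
  by rewrite eqxx; case: (eqVneq b a).
case: (eqVneq x b) => [->|xb]; first by rewrite eqxx.
by rewrite (negbTE xa) (negbTE xb).
Qed.

Definition swap a b : fperm atom := FPerm (swap_subproof a b).

(* conj_fperm pi rho is pi^rho = rho o pi o rho^-1 *)
Definition conj_fperm pi rho : fperm atom :=
  comp_fperm rho (comp_fperm pi (inv_fperm rho)).

End Permutations.

Record signature := Signature {
  symbol :> Type;
  arity : symbol -> nat
}.

Section NominalTerms.
Context {atom var : choiceType} {Sigma : signature}.

Inductive nterm : Type :=
| Atom of atom
| Susp of fperm atom & var
| Abs of atom & nterm
| App (f : Sigma) of {ffun 'I_(arity f) -> nterm}.

Fixpoint act (pi : fperm atom) (t : nterm) : nterm :=
  match t with
  | Atom a => Atom (pi a)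
  | Susp rho X => Susp (comp_fperm pi rho) X
  | Abs a t => Abs (pi a) (act pi t)
  | App f ts => App [ffun i => act pi (ts i)]
  end.

(* All atoms occurring syntactically, including abstracted atoms and those
   moved by suspended permutations. *)
Fixpoint atoms_of (t : nterm) : {fset atom} :=
  match t with
  | Atom a => [fset a]
  | Susp rho X => finsupp rho
  | Abs a t => a |` atoms_of t
  | App f ts => \big[fsetU/fset0]_(i < arity f) atoms_of (ts i)
  end.

(* (a, c, X) stands for the primitive constraint (a c) fix X, where c is bound
   by the new-quantifier. *)
Definition context := {fset atom * atom * var}.

Definition strong_context (A C : {pred atom}) (U : context) : Prop :=
  (forall a, a \in A -> a \notin C) /\
  (forall p, p \in U -> p.1.1 \in A /\ p.1.2 \in C).

(* dom(perm(U|_X)) *)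
Definition ctx_dom (U : context) (X : var) : {fset atom} :=
  [fset p.1.1 | p in U & p.2 == X].

Definition ctx_atoms (U : context) : {fset atom} :=
  [fset p.1.1 | p in U] `|` [fset p.1.2 | p in U].

(* c1 does not occur in any component of the judgement  new cs. U |- ...;
   the components pi, s, t, ... contribute the atoms in D. *)
Definition new_atom (cs : seq atom) (U : context) (D : {fset atom})
    (c1 : atom) : Prop :=
  [/\ c1 \notin cs, c1 \notin ctx_atoms U & c1 \notin D].

Implicit Types (cs : seq atom) (pi rho : fperm atom) (a b : atom) (s t : nterm).

(* fixes U cs pi t  is derivability of  new cs. (U |- pi fix t) *)
Inductive fixes (U : context) : seq atom -> fperm atom -> nterm -> Prop :=
| fixes_atom cs pi a :
    pi a = a ->
    fixes U cs pi (Atom a)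
| fixes_susp cs pi rho X :
    finsupp (conj_fperm pi (inv_fperm rho))
      `\` [fset c | c in cs] `<=` ctx_dom U X ->
    fixes U cs pi (Susp rho X)
| fixes_app cs pi f (ts : {ffun 'I_(arity f) -> nterm}) :
    (forall i, fixes U cs pi (ts i)) ->
    fixes U cs pi (App ts)
| fixes_abs cs pi a t c1 :
    new_atom cs U (finsupp pi `|` (a |` atoms_of t)) c1 ->
    fixes U (rcons cs c1) pi (act (swap a c1) t) ->
    fixes U cs pi (Abs a t).

(* aeq U cs s t  is derivability of  new cs. (U |- s =alpha t).  In aeq_abs_diff
   distinct metavariables denote distinct atoms, as usual for nominal terms. *)
Inductive aeq (U : context) : seq atom -> nterm -> nterm -> Prop :=
| aeq_atom cs a :
    aeq U cs (Atom a) (Atom a)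
| aeq_susp cs pi rho X :
    finsupp (comp_fperm (inv_fperm rho) pi)
      `\` [fset c | c in cs] `<=` ctx_dom U X ->
    aeq U cs (Susp pi X) (Susp rho X)
| aeq_app cs f (ss ts : {ffun 'I_(arity f) -> nterm}) :
    (forall i, aeq U cs (ss i) (ts i)) ->
    aeq U cs (App ss) (App ts)
| aeq_abs_same cs a s t :
    aeq U cs s t ->
    aeq U cs (Abs a s) (Abs a t)
| aeq_abs_diff cs a b s t c1 :
    a != b ->
    new_atom cs U (a |` (b |` (atoms_of s `|` atoms_of t))) c1 ->
    aeq U cs s (act (swap a b) t) ->
    fixes U (rcons cs c1) (swap a c1) t ->
    aeq U cs (Abs a s) (Abs b t).

End NominalTerms.

Arguments nterm : clear implicits.
Arguments context : clear implicits.

(* Main.v *)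
Require Import Defs.
From mathcomp Require Import all_boot finmap.

(** Both judgements are governed by freshness of single atoms. Let [b # t] be
    the usual freshness relation of nominal terms, where [b # X] means that [b]
    is new or occurs in [dom(perm(U|_X))]. Then [pi] fixes [t] iff every atom
    moved by [pi] is fresh for [t], and, for all [pi] and [rho],
    [act pi t] and [act rho t] are alpha-equal iff every atom on which [pi] and
    [rho] disagree is fresh for [t]. Taking [rho] to be the identity makes the
    two conditions coincide. *)

Set Implicit Arguments.
Unset Strict Implicit.
Unset Printing Implicit Defensive.

Local Open Scope fset_scope.

(** * Finite permutations: inverses, composition and swaps *)

Section PermutationFacts.
Context {atom : choiceType}.
Implicit Types (pi rho : fperm atom) (a b x : atom).

Lemma fperm_injective pi : injective pi.
Proof. by apply/fsinjectiveP; apply: fperm_inj. Qed.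

Lemma inv_fpermK pi : cancel pi (inv_fperm pi).
Proof. by move=> x; apply: (@fperm_injective pi); rewrite inv_fpermKV. Qed.

Lemma fperm_ext pi rho : pi =1 rho -> pi = rho.
Proof. by move=> e; apply/val_inj/fsfunP. Qed.

Lemma swapE a b x : swap a b x = if x == a then b else if x == b then a else x.
Proof. exact: swap_funE. Qed.

Lemma swapR a b : swap a b b = a.
Proof. by rewrite swapE eqxx; case: eqVneq. Qed.

Lemma swapD a b x : x != a -> x != b -> swap a b x = x.
Proof. by rewrite swapE => /negbTE-> /negbTE->. Qed.

Lemma inv_fperm_comp pi rho x :
  inv_fperm (comp_fperm pi rho) x = inv_fperm rho (inv_fperm pi x).
Proof.
apply: (@fperm_injective (comp_fperm pi rho)).
by rewrite inv_fpermKV comp_fpermE !inv_fpermKV.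
Qed.

Lemma inv_fpermV pi : inv_fperm (inv_fperm pi) = pi.
Proof.
by apply: fperm_ext => x; rewrite -[in LHS](inv_fpermK pi x) inv_fpermK.
Qed.

End PermutationFacts.

(** * The action on terms and the freshness relation *)

Section Freshness.
Context {atom var : choiceType} {Sigma : signature}.
Implicit Types (U : context atom var) (cs : seq atom) (pi rho : fperm atom).
Implicit Types (a b c x : atom) (s t : nterm atom var Sigma).

(* The generated principle gives no induction hypothesis for the arguments of
   [App], which sit under the nested type of finite functions. *)
Lemma nterm_nested_ind (P : nterm atom var Sigma -> Prop) :
  (forall a, P (Atom a)) ->
  (forall pi X, P (Susp pi X)) ->
  (forall a t, P t -> P (Abs a t)) ->
  (forall f (ts : {ffun 'I_(arity f) -> nterm atom var Sigma}),
     (forall i, P (ts i)) -> P (App ts)) ->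
  forall t, P t.
Proof.
move=> Patom Psusp Pabs Papp; fix IH 1 => -[a|pi X|a t|f ts].
- exact: Patom.
- exact: Psusp.
- exact/Pabs/IH.
- by apply: Papp => i; apply: IH.
Qed.

Lemma act_comp pi rho t : act pi (act rho t) = act (comp_fperm pi rho) t.
Proof.
elim/nterm_nested_ind: t => [a|sigma X|a t IH|f ts IH] /=.
- by rewrite fscompE.
- by congr Susp; apply: fperm_ext => x; rewrite !comp_fpermE.
- by rewrite IH fscompE.
- by congr App; apply/ffunP => i; rewrite !ffunE IH.
Qed.

Lemma act_id pi t : pi =1 id -> act pi t = t.
Proof.
move=> pi1; elim/nterm_nested_ind: t => [a|sigma X|a t IH|f ts IH] /=.
- by rewrite pi1.
- by congr Susp; apply: fperm_ext => x; rewrite comp_fpermE pi1.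
- by rewrite IH pi1.
- by congr App; apply/ffunP => i; rewrite !ffunE IH.
Qed.

Fixpoint fresh U cs b t : bool :=
  match t with
  | Atom a => b != a
  | Susp rho X =>
      (inv_fperm rho b \in cs) || (inv_fperm rho b \in ctx_dom U X)
  | Abs a t => (b == a) || fresh U cs b t
  | App f ts => [forall i, fresh U cs b (ts i)]
  end.

(** Neither [cs] nor [U] has to be renamed, because suspensions absorb [rho]: the inverse of
    [comp_fperm rho sigma] sends [rho b] to [inv_fperm sigma b]. *)
Lemma fresh_act U cs rho b t :
  fresh U cs (rho b) (act rho t) = fresh U cs b t.
Proof.
elim/nterm_nested_ind: t => [a|sigma X|a t IH|f ts IH].
- by rewrite /= (inj_eq (@fperm_injective _ rho)).
- by rewrite /fresh /act inv_fperm_comp inv_fpermK.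
- by rewrite /= (inj_eq (@fperm_injective _ rho)) IH.
- by rewrite /=; apply: eq_forallb => i; rewrite ffunE IH.
Qed.

Lemma atoms_of_arg f (ts : {ffun 'I_(arity f) -> nterm atom var Sigma}) i c :
  c \notin atoms_of (App ts) -> c \notin atoms_of (ts i).
Proof.
apply: contra => /=; apply/fsubsetP.
by rewrite (bigD1 i) //=; apply: fsubsetUl.
Qed.

(** Each suspended permutation fixes [c], so it cannot carry [c] to [b]. *)
Lemma fresh_rcons U cs c b t : c \notin atoms_of t -> b != c ->
  fresh U (rcons cs c) b t = fresh U cs b t.
Proof.
move=> + bc; elim/nterm_nested_ind: t => [a|rho X|a t IH|f ts IH] ct //=.
- rewrite mem_rcons inE; suff /negbTE -> : inv_fperm rho b != c by [].
  apply: contra bc => /eqP bc; rewrite -(inv_fpermKV rho b) bc.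
  by rewrite fsfun_dflt.
- by move: ct; rewrite /= !inE negb_or => /andP[_ /IH ->].
- by apply: eq_forallb => i; rewrite IH // atoms_of_arg.
Qed.

Lemma fresh_new U cs c t : c \notin atoms_of t -> fresh U (rcons cs c) c t.
Proof.
elim/nterm_nested_ind: t => [a|rho X|a t IH|f ts IH] ct /=.
- by rewrite !inE in ct.
- suff -> : inv_fperm rho c = c by rewrite mem_rcons inE eqxx.
  by apply: (@fperm_injective _ rho); rewrite inv_fpermKV fsfun_dflt.
- by move: ct; rewrite /= !inE negb_or => /andP[_ /IH ->]; rewrite orbT.
- by apply/forallP => i; rewrite IH // atoms_of_arg.
Qed.

(** This undoes the renaming in [fixes_abs]: for [b = a] the swap reduces the question to the new
    atom [c], which is always fresh; any other [b] is left in place. *)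
Lemma fresh_abs U cs a b c t : c \notin atoms_of t -> b != c ->
  fresh U (rcons cs c) b (act (swap a c) t) = fresh U cs b (Abs a t).
Proof.
move=> ct bc /=; case: (eqVneq b a) => [->|ba] /=.
  by rewrite -{1}(swapR a c) fresh_act fresh_new.
by rewrite -{1}(swapD ba bc) fresh_act fresh_rcons.
Qed.

(** Common form of the side conditions of [fixes_susp] and [aeq_susp], with [D] the conjugate or the
    quotient permutation. Applying [rho] to [b] cancels the inverse in [fresh]. *)
Lemma fresh_support_susp U cs rho X (D : fperm atom) :
  finsupp D `\` [fset c | c in cs] `<=` ctx_dom U X <->
  forall b, D b != b -> fresh U cs (rho b) (Susp rho X : nterm atom var Sigma).
Proof.
split=> [/fsubsetP sub b Db|fr].
  rewrite /fresh inv_fpermK; case: (boolP (b \in cs)) => //= bcs.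
  apply: sub; rewrite in_fsetD mem_finsupp Db andbT.
  by apply/imfsetP => -[x /= xcs bx]; rewrite bx xcs in bcs.
apply/fsubsetP => b; rewrite in_fsetD mem_finsupp => /andP[bcs /fr].
rewrite /fresh inv_fpermK => /orP[bcs'|//].
by case/imfsetP: bcs; exists b.
Qed.

(** * Both judgements characterised by freshness *)

Lemma fixes_fresh U cs pi t : fixes U cs pi t ->
  forall b, pi b != b -> fresh U cs b t.
Proof.
elim=> {cs pi t} [cs pi a pia|cs pi rho X sub|cs pi f ts _ IH|
                  cs pi a t c [_ _ cD] _ IH] b pib.
- by apply: contraNneq pib => ->; rewrite pia.
(* The conjugate moves [inv_fperm rho b] exactly when [pi] moves [b]. *)
- move/fresh_support_susp: sub => /(_ rho (inv_fperm rho b)).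
  rewrite inv_fpermKV /conj_fperm !comp_fpermE inv_fpermV inv_fpermKV.
  by apply; rewrite (inj_eq (@fperm_injective _ (inv_fperm rho))).
- by apply/forallP => i; apply: IH.
- move: cD; rewrite !in_fsetU mem_finsupp !negb_or negbK => /and3P[pic _ ct].
  by rewrite -(@fresh_abs _ _ _ _ c) ?IH //; apply: contraNneq pib => ->.
Qed.

Lemma aeq_inv U cs s t : aeq U cs s t ->
  match s, t with
  | Atom a, Atom b => a = b
  | Susp pi X, Susp rho Y =>
      X = Y /\ finsupp (comp_fperm (inv_fperm rho) pi)
                 `\` [fset c | c in cs] `<=` ctx_dom U X
  | Abs a s, Abs b t =>
      a = b /\ aeq U cs s t \/
      [/\ a != b, aeq U cs s (act (swap a b) t) & exists c,
        [/\ c != a, c \notin atoms_of t & fixes U (rcons cs c) (swap a c) t]]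
  (* [f] and [g] are only propositionally equal, hence the two indices. *)
  | App f ss, App g ts => forall (i : 'I_(arity f)) (j : 'I_(arity g)),
      i = j :> nat -> aeq U cs (ss i) (ts j)
  | _, _ => False
  end.
Proof.
case=> {cs s t} [//|//|cs f ss ts H i j /val_inj-> //|cs a s t H|
                 cs a b s t c ab [_ _ cD] st fix_t]; first by left.
right; split=> //; exists c; split=> //; move: cD; rewrite !inE !negb_or.
  by case/andP.
by case/and4P.
Qed.

Hypothesis atom_infinite : forall s : seq atom, exists a, a \notin s.

Lemma exists_new_atom cs U (D : {fset atom}) : exists c, new_atom cs U D c.
Proof.
have [c] := atom_infinite (cs ++ ctx_atoms U ++ D).
by rewrite !mem_cat !negb_or => /and3P[? ? ?]; exists c.
Qed.

(* The statement is about [act rho t] because [fixes_abs] recurses on a renamed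
   body, which is not a subterm. *)
Lemma fresh_fixes_act U cs pi rho t :
  (forall b, pi b != b -> fresh U cs b (act rho t)) ->
  fixes U cs pi (act rho t).
Proof.
elim/nterm_nested_ind: t cs rho => [a|sigma X|a t IH|f ts IH] cs rho fr.
- by apply/fixes_atom/eqP; apply: contraT => /fr /=; rewrite eqxx.
- rewrite /act in fr *; set r := comp_fperm rho sigma in fr *.
  apply/fixes_susp/(@fresh_support_susp _ _ r) => b.
  rewrite /conj_fperm 2!comp_fpermE inv_fpermV => Db; apply: fr.
  by apply: contraNneq Db => ->; rewrite inv_fpermK.
- have [c cP] := exists_new_atom cs U
    (finsupp pi `|` (rho a |` atoms_of (act rho t))).
  apply: fixes_abs (cP) _; rewrite act_comp; apply: IH => b pib.
  case: cP => _ _; rewrite !in_fsetU mem_finsupp !negb_or negbK.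
  case/and3P=> /eqP pic _ ct; rewrite -act_comp fresh_abs ?fr //.
  by apply: contraNneq pib => ->; rewrite pic.
- apply: fixes_app => i; rewrite ffunE; apply: IH => b /fr /forallP /(_ i).
  by rewrite ffunE.
Qed.

Lemma fixesP U cs pi t :
  fixes U cs pi t <-> forall b, pi b != b -> fresh U cs b t.
Proof.
split=> [|fr]; first exact: fixes_fresh.
have one : comp_fperm pi (inv_fperm pi) =1 id.
  by move=> x; rewrite comp_fpermE inv_fpermKV.
by rewrite -(act_id t one); apply: fresh_fixes_act; rewrite act_id.
Qed.

(** Handles the last premise of [aeq_abs_diff]: the swap moves only [a] and [c], and [c] is fresh
    once it has joined the list. *)
Lemma fixes_swap_new U cs a c t : c != a -> c \notin atoms_of t ->
  fixes U (rcons cs c) (swap a c) t <-> fresh U cs a t.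
Proof.
move=> ca ct; rewrite fixesP; split=> [fr|fr b].
  by rewrite -(@fresh_rcons _ _ c) 1?eq_sym // fr // swapE eqxx.
case: (eqVneq b c) => [-> _|bc]; first exact: fresh_new.
case: (eqVneq b a) => [-> _|ba]; first by rewrite fresh_rcons // eq_sym.
by rewrite swapD ?eqxx.
Qed.

(** The induction needs two arbitrary permutations, since [aeq_abs_diff] composes the right-hand one
    with a swap. *)
Lemma aeq_act U cs pi rho t :
  aeq U cs (act pi t) (act rho t) <->
  forall b, pi b != rho b -> fresh U cs b t.
Proof.
elim/nterm_nested_ind: t pi rho => [a|sigma X|a t IH|f ts IH] pi rho.
- split=> [/aeq_inv /= e b|fr].
    by apply: contraNneq => ->; rewrite e.
  suff /eqP/= -> : pi a == rho a by apply: aeq_atom.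
  by apply: contraT => /fr /=; rewrite eqxx.
- rewrite [act pi _]/act [act rho _]/act.
  have dis b : comp_fperm (inv_fperm (comp_fperm rho sigma))
      (comp_fperm pi sigma) b != b = (pi (sigma b) != rho (sigma b)).
    rewrite comp_fpermE -(inj_eq (@fperm_injective _ (comp_fperm rho sigma))).
    by rewrite inv_fpermKV !comp_fpermE.
  split=> [/aeq_inv[_ /(@fresh_support_susp _ _ sigma) fr] b|fr].
    by rewrite -(inv_fpermKV sigma b) => pr; apply: fr; rewrite dis.
  apply/aeq_susp/(@fresh_support_susp _ _ sigma) => b.
  by rewrite dis => /fr.
- rewrite [act pi _]/= [act rho _]/=.
  case: (eqVneq (pi a) (rho a)) => [e|ne].
    (* [a] is outside the disagreement set, so binding it changes nothing. *)
    have -> : (forall b, pi b != rho b -> fresh U cs b (Abs a t)) <->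
              (forall b, pi b != rho b -> fresh U cs b t).
      split=> fr b pr; last by rewrite /= fr ?orbT.
      by case/orP: (fr b pr) => // /eqP ba; rewrite ba e eqxx in pr.
    rewrite -IH; split=> [/aeq_inv[[]//|[]]|]; first by rewrite e eqxx.
    by rewrite e; apply: aeq_abs_same.
  (* [x0] is the atom other than [a] whose image under [rho] is exchanged by
     [swap (pi a) (rho a)]; it lies in the disagreement set of [pi], [rho]. *)
  pose x0 := inv_fperm rho (pi a).
  have rx0 : rho x0 = pi a by rewrite inv_fpermKV.
  have x0a : x0 != a by apply: contraNneq ne => e; rewrite -rx0 e.
  have swD b : b != a -> b != x0 -> swap (pi a) (rho a) (rho b) = rho b.
    move=> ba bx0; apply: swapD; last by rewrite (inj_eq (@fperm_injective _ _)).
    by rewrite -rx0 (inj_eq (@fperm_injective _ _)).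
  (* Composing [rho] with the swap creates agreement at [a], which is fresh for the abstraction
     anyway, and alters no other value except at [x0]; there, the second conjunct supplies
     freshness, as [pi a] is [rho x0]. *)
  have key : (forall b, pi b != rho b -> fresh U cs b (Abs a t)) <->
      aeq U cs (act pi t) (act (swap (pi a) (rho a)) (act rho t)) /\
      fresh U cs (pi a) (act rho t).
    rewrite act_comp IH -rx0 fresh_act rx0.
    split=> [fr|[fr frx0] b pr]; last rewrite [fresh _ _ _ _]/=.
      have frx0 : fresh U cs x0 t.
        have /= := fr x0; rewrite (negbTE x0a) /=; apply.
        by rewrite rx0 (inj_eq (@fperm_injective _ pi)).
      split=> // b; case: (eqVneq b x0) => [-> //|bx0].
      rewrite comp_fpermE; case: (eqVneq b a) => [->|ba].
        by rewrite swapR eqxx.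
      by rewrite swD // => /fr /=; rewrite (negbTE ba).
    case: (eqVneq b a) => //= ba; case: (eqVneq b x0) => [-> //|bx0].
    by apply: fr; rewrite comp_fpermE swD.
  rewrite key; split=> [/aeq_inv[[e]|[_ eqt [c [ca ct /fixes_swap_new]]]]|].
  + by rewrite e eqxx in ne.
  + by split; auto.
  case=> eqt fra; have [c cP] := exists_new_atom cs U
    (pi a |` (rho a |` (atoms_of (act pi t) `|` atoms_of (act rho t)))).
  apply: aeq_abs_diff ne (cP) eqt _.
  case: cP => _ _; rewrite !inE !negb_or => /and4P[ca _ _ ct].
  exact/fixes_swap_new.
- split=> [/aeq_inv /= H b pr|fr].
    apply/forallP => i; move: b pr; apply/IH.
    by have := H i i erefl; rewrite !ffunE.
  apply: aeq_app => i; rewrite !ffunE; apply/IH => b /fr.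
  by move/forallP/(_ i).
Qed.

End Freshness.

Theorem theorem5p3 (atom var : choiceType) (Sigma : signature)
    (atom_infinite : forall s : seq atom, exists a, a \notin s)
    (A : {pred atom}) (c0 cs : seq atom) (U : context atom var)
    (uniq_cs : uniq cs) (c0_sub : {subset c0 <= cs})
    (strongU : strong_context A [in c0] U)
    (pi : fperm atom) (t : nterm atom var Sigma) :
  fixes U cs pi t <-> aeq U cs (act pi t) t.
Proof.
(* A form of the identity permutation, so that the right-hand [t] becomes [act one t] and [aeq_act]
   applies. *)
pose one := comp_fperm pi (inv_fperm pi).
have oneE : one =1 id by move=> x; rewrite comp_fpermE inv_fpermKV.
rewrite -{3}(act_id t oneE) aeq_act // fixesP //.
by split=> fr b pib; apply: fr; move: pib; rewrite oneE.
Qed.
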